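(* Let $(u,q)$ be a (sufficiently smooth) solution, $L$-periodic in $x$, of the system $$\partial_t u=\mathcal{D}\Big(q+u\frac{\partial g}{\partial u}-\partial_x\Big(u\frac{\partial g}{\partial u_x}\Big)\Big),\qquad \partial_t q=\frac{\partial g}{\partial u}\,u_t+\frac{\partial g}{\partial u_x}\,\partial_x u_t,$$ where $g(u,u_x)=-\frac12(u^2+u_x^2)$, so that $\frac{\partial g}{\partial u}=-u$ and $\frac{\partial g}{\partial u_x}=-u_x$, with consistent initial conditions $u(x,0)=u_0(x)$, $q(x,0)=-\frac12\big(u(x,0)^2+u_x(x,0)^2\big)$. Then the quadratic energy $\mathcal{H}=\int_\Omega u\,q\,dx$ is conserved: $$\frac{d}{dt}\mathcal{H}=0 .$$
   Context: $\Omega=[a,a+L]$ is a bounded interval, and all functions of $x$ are real-valued and periodic with period $L$; $t\in[0,T]$. $\mathcal{D}=(1-\partial_{xx})^{-1}\partial_x$, acting on $L$-periodic functions; it is skew-adjoint with respect to the $L^2$-inner product $(f,g)=\int_\Omega fg\,dx$. The system is a reformulation of the Camassa-Holm equation $u_t-u_{xxt}+3uu_x-2u_xu_{xx}-uu_{xxx}=0$ with periodic boundary condition $u(x+L,t)=u(x,t)$ and initial datum $u_0$, with auxiliary variable $q=-\frac12(u^2+u_x^2)$. *)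

(* Defs.v *)
(* Stdlib reals with Coquelicot. *)
From Stdlib Require Import Reals Lra Lia.
From Coquelicot Require Import Coquelicot.
Open Scope R_scope.

Definition periodic (L : R) (f : R -> R) : Prop := forall x, f (x + L) = f x.

(* Graph of the inverse of [1 - d_xx] on [L]-periodic functions. *)
Definition is_helmholtz_inv (L : R) (h v : R -> R) : Prop :=
  periodic L v /\
  (forall x, ex_derive_n v 1 x /\ ex_derive_n v 2 x) /\
  (forall x, v x - Derive_n v 2 x = h x).

(* [is_D L f w] reads [w = (1 - d_xx)^-1 d_x f]; [w] is determined by [f], see
   [is_helmholtz_inv_unique]. *)
Definition is_D (L : R) (f w : R -> R) : Prop :=
  periodic L f /\ (forall x, ex_derive f x) /\ is_helmholtz_inv L (Derive f) w.

(* The derivative of [f] relative to [[0, T]] at [t]: the usual one for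
   [0 < t < T], the one-sided one at the end points. *)
Definition is_derive_t (T : R) (f : R -> R) (t l : R) : Prop :=
  filterdiff f (within (fun s => 0 <= s <= T) (locally t)) (fun h => scal h l).

(* Functions of time and space are written [f t x]. *)
Definition continuous_tx (T : R) (f : R -> R -> R) : Prop :=
  continuous_on (fun p : R * R => 0 <= fst p <= T)
                (fun p : R * R => f (fst p) (snd p)).

(* The [x]-derivatives of [f] of order at most [k] exist and are jointly
   continuous on [[0, T] * R]. *)
Definition smooth_x (k : nat) (T : R) (f : R -> R -> R) : Prop :=
  forall j, (j <= k)%nat ->
    (forall t x, 0 <= t <= T -> ex_derive_n (f t) j x) /\
    continuous_tx T (fun t x => Derive_n (f t) j x).

Definition g (u ux : R) : R := - (1 / 2) * (u ^ 2 + ux ^ 2).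
Definition dg_du (u ux : R) : R := Derive (fun v => g v ux) u.
Definition dg_dux (u ux : R) : R := Derive (fun v => g u v) ux.

(* [q + u g_u - d_x (u g_ux)], at a fixed time *)
Definition flux (u q : R -> R) (x : R) : R :=
  q x + u x * dg_du (u x) (Derive u x)
  - Derive (fun y => u y * dg_dux (u y) (Derive u y)) x.

(* Classical solutions: "sufficiently smooth" is read as the existence and joint
   continuity of the derivatives that occur in the two equations, where
   [D (flux)] involves [u] up to order 3 and [q] up to order 1, and [u_t] is
   in the domain of [1 - d_xx].  [ut] and [qt] are the time derivatives. *)
Definition is_solution (L T : R) (u0 : R -> R) (u q : R -> R -> R) : Prop :=
  exists ut qt : R -> R -> R,
    (forall t x, 0 <= t <= T ->
       is_derive_t T (fun s => u s x) t (ut t x) /\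
       is_derive_t T (fun s => q s x) t (qt t x)) /\
    (smooth_x 3 T u /\ smooth_x 2 T ut /\ smooth_x 1 T q /\ smooth_x 0 T qt) /\
    (forall t, 0 <= t <= T -> periodic L (u t) /\ periodic L (q t)) /\
    (forall t, 0 <= t <= T -> is_D L (flux (u t) (q t)) (ut t)) /\
    (forall t x, 0 <= t <= T ->
       qt t x = dg_du (u t x) (Derive (u t) x) * ut t x
                + dg_dux (u t x) (Derive (u t) x) * Derive (ut t) x) /\
    (forall x, u 0 x = u0 x) /\
    (forall x, q 0 x = g (u 0 x) (Derive (u 0) x)).

Definition energy (a L : R) (u q : R -> R -> R) (t : R) : R :=
  RInt (fun x => u t x * q t x) a (a + L).

Lemma dg_duE u ux : dg_du u ux = - u.
Proof. apply is_derive_unique; unfold g; auto_derive; [easy | field]. Qed.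

Lemma dg_duxE u ux : dg_dux u ux = - ux.
Proof. apply is_derive_unique; unfold g; auto_derive; [easy | field]. Qed.

Lemma derive_zero_const (f : R -> R) :
  (forall x, is_derive f x 0) -> forall x y, f x = f y.
Proof.
intros Hf.
assert (K : forall x y, x < y -> f x = f y).
{ intros x y Hxy. apply (eq_is_derive f x y); [intros t _; exact (Hf t) | easy]. }
intros x y. destruct (Rtotal_order x y) as [H | [-> | H]]; auto.
symmetry; auto.
Qed.

(* A periodic solution of [z' = c z] with [c = 1] or [c = -1] vanishes. *)
Lemma periodic_exp_zero (L c : R) (z : R -> R) : 0 < L -> c <> 0 ->
  periodic L z -> (forall x, is_derive z x (c * z x)) -> forall x, z x = 0.
Proof.
intros HL Hc Hp Hz x.
assert (K : z x * exp (- c * x) = z (x + L) * exp (- c * (x + L))).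
{ apply (derive_zero_const (fun y => z y * exp (- c * y))); intros y.
  auto_derive; [exists (c * z y); apply Hz |].
  change (Derive (fun s => z s) y) with (Derive z y).
  rewrite (is_derive_unique _ _ _ (Hz y)); ring. }
rewrite Hp in K.
destruct (Req_dec (z x) 0) as [E | E]; [exact E | exfalso].
apply Rmult_eq_reg_l in K; [| exact E].
apply exp_inv in K.
assert (K' : c * L = 0) by lra.
apply Rmult_integral in K'; destruct K'; lra.
Qed.

Lemma is_helmholtz_inv_unique (L : R) (h v w : R -> R) : 0 < L ->
  is_helmholtz_inv L h v -> is_helmholtz_inv L h w -> forall x, v x = w x.
Proof.
intros HL [Pv [Ev Hv]] [Pw [Ew Hw]].
assert (dP : forall f, periodic L f -> periodic L (Derive f)).
{ intros f Pf x. change (Derive_n f 1 (x + L) = Derive_n f 1 x).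
  rewrite <- Derive_n_comp_trans. now apply Derive_n_ext. }
set (z := fun x => v x - w x).
set (z' := fun x => Derive v x - Derive w x).
assert (D1 : forall x, is_derive z x (z' x)).
{ intros x. apply @is_derive_minus; apply Derive_correct; [apply Ev | apply Ew]. }
assert (D2 : forall x, is_derive z' x (z x)).
{ intros x. replace (z x) with (minus (Derive_n v 2 x) (Derive_n w 2 x)).
  - apply @is_derive_minus; apply Derive_correct; [apply Ev | apply Ew].
  - unfold z, minus, plus, opp; simpl.
    specialize (Hv x); specialize (Hw x); simpl in Hv, Hw; lra. }
assert (Pz : periodic L z) by (intros x; unfold z; now rewrite Pv, Pw).
assert (Pz' : periodic L z').
{ intros x; unfold z'; now rewrite (dP v Pv x), (dP w Pw x). }
assert (S : forall x, z x + z' x = 0).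
{ apply (periodic_exp_zero L 1); [easy | lra | |].
  - intros x; now rewrite Pz, Pz'.
  - intros x. replace (1 * (z x + z' x)) with (plus (z' x) (z x))
      by (unfold plus; simpl; ring).
    apply @is_derive_plus; auto. }
intros x. apply Rminus_diag_uniq. fold (z x).
apply (periodic_exp_zero L (-1)); [easy | lra | easy |].
intros y. replace (-1 * z y) with (z' y) by (specialize (S y); lra). apply D1.
Qed.

(* Main.v *)
Require Import Defs.
From Stdlib Require Import Reals Lra Lia.
From Coquelicot Require Import Coquelicot.
Open Scope R_scope.

(* With [w = u_t], the equation for [q_t] gives [(u q)_t = w F - (w u u_x)_x], where
   [F] is the flux.  The last term has zero mean by periodicity, and so has [w F]
   because [w = D F] with [D] skew-adjoint.  It remains to differentiate under the
   integral, with one-sided derivatives at [t = 0] and [t = T]. *)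

Lemma periodic_Derive (L : R) (f : R -> R) : periodic L f -> periodic L (Derive f).
Proof.
intros Pf x. change (Derive_n f 1 (x + L) = Derive_n f 1 x).
rewrite <- Derive_n_comp_trans. now apply Derive_n_ext.
Qed.

(** * Calculus of derivatives relative to [[0, T]] *)

Lemma within_Icc_proper (T t : R) : 0 <= t <= T ->
  ProperFilter (within (fun s => 0 <= s <= T) (locally t)).
Proof.
intros Ht; split; [| apply within_filter, locally_filter].
intros P HP; exists t. now apply (locally_singleton t _ HP).
Qed.

Lemma is_derive_t_continuous (T : R) (f : R -> R) (t l : R) :
  is_derive_t T f t l ->
  filterlim f (within (fun s => 0 <= s <= T) (locally t)) (locally (f t)).
Proof.
intros Hf. apply (filterdiff_continuous_aux (K := R_AbsRing)
  (U := R_NormedModule) (V := R_NormedModule)).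
- now exists (fun h => scal h l).
- intros P HP. now apply filter_le_within.
Qed.

Lemma is_derive_t_mult (T : R) (f g : R -> R) (t lf lg : R) : 0 <= t <= T ->
  is_derive_t T f t lf -> is_derive_t T g t lg ->
  is_derive_t T (fun s => f s * g s) t (lf * g t + f t * lg).
Proof.
intros Ht Hf Hg.
pose proof (within_Icc_proper T t Ht) as HF.
apply filterdiff_ext_lin with
  (fun h => plus (mult (scal h lf) (g t)) (mult (f t) (scal h lg))).
2:{ intros h; unfold plus, mult, scal; simpl; unfold mult; simpl; ring. }
apply (filterdiff_comp_2 f g (@mult R_AbsRing) _ _
  (fun x y => plus (mult x (g t)) (mult (f t) y)) Hf Hg).
apply (filterdiff_mult (K := R_AbsRing) (f t, g t)).
(* The product on pairs is differentiated along the image of the time filter under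
   [s => (f s, g s)]; that this image converges to [(f t, g t)] is the relative continuity of both
   factors. *)
- intros P [e He].
  generalize (proj1 (filterlim_locally _ _) (is_derive_t_continuous _ _ _ _ Hf) e)
             (proj1 (filterlim_locally _ _) (is_derive_t_continuous _ _ _ _ Hg) e).
  intros A B. unfold filtermap. generalize (filter_and _ _ A B).
  apply filter_imp. intros s [H1 H2]. apply He. now split.
- intros; apply Rmult_comm.
Qed.

(** Here [[0, T]] is a neighbourhood of [t], so the constraint [0 <= s <= T] holds near [t] and can
    be discharged. *)
Lemma is_derive_t_interior (T : R) (f : R -> R) (t l : R) : 0 < t < T ->
  is_derive_t T f t l -> is_derive f t l.
Proof.
intros Ht [Hlin H]; split; [exact Hlin |].
intros x Hx e. apply (is_filter_lim_locally_unique (V := R_NormedModule)) in Hx; subst x.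
assert (D : locally t (fun s => 0 <= s <= T)).
{ assert (He : 0 < Rmin t (T - t)) by (apply Rmin_pos; lra).
  exists (mkposreal _ He). intros s Hs.
  apply Rabs_lt_between' in Hs; simpl in Hs.
  generalize (Rmin_l t (T - t)) (Rmin_r t (T - t)); lra. }
assert (Lt : is_filter_lim (within (fun s => 0 <= s <= T) (locally t)) t)
  by (intros P HP; now apply filter_le_within).
specialize (H t Lt e).
generalize (filter_and _ _ D H). apply filter_imp. intros s [H1 H2]; auto.
Qed.

Lemma is_derive_t_eps (T : R) (f : R -> R) (t l : R) : 0 <= t <= T ->
  (forall eps : posreal, exists delta : posreal, forall s, 0 <= s <= T ->
     Rabs (s - t) < delta -> Rabs (f s - f t - (s - t) * l) <= eps * Rabs (s - t)) ->
  is_derive_t T f t l.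
Proof.
intros Ht H; split; [apply (is_linear_scal_l (K := R_AbsRing) (V := R_NormedModule)) |].
intros x Hx.
(* [filterdiff] quantifies over every limit [x] of its filter; the filter is proper, so [t] is the
   only one. *)
assert (E : t = x).
{ pose proof (within_Icc_proper T t Ht).
  apply (is_filter_lim_unique (V := R_NormedModule)
    (F := within (fun s => 0 <= s <= T) (locally t))); [| exact Hx].
  intros P HP. now apply filter_le_within. }
subst x. intros e. destruct (H e) as [d Hd].
exists d. intros s Hs HsT. now apply Hd.
Qed.

(** * Extension of functions from [[0, T]] to all times, and joint continuity *)

Definition clamp (T s : R) : R := Rmax 0 (Rmin s T).

Lemma clamp_bounds (T s : R) : 0 <= T -> 0 <= clamp T s <= T.
Proof.
intros HT; unfold clamp, Rmax, Rmin; repeat destruct Rle_dec; lra.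
Qed.

Lemma clamp_id (T s : R) : 0 <= s <= T -> clamp T s = s.
Proof.
intros HT; unfold clamp, Rmax, Rmin; repeat destruct Rle_dec; lra.
Qed.

Lemma clamp_lipschitz (T s t : R) : Rabs (clamp T s - clamp T t) <= Rabs (s - t).
Proof.
unfold clamp, Rmax, Rmin, Rabs; repeat destruct Rle_dec; repeat destruct Rcase_abs; lra.
Qed.

(** [clamp] is a 1-Lipschitz retraction onto [[0, T]], so it maps the ball around [t] into the part
    of that ball inside [[0, T]]. One-sided continuity at [0] and [T] thus becomes the two-sided
    continuity that the mean value theorem asks for. *)
Lemma continuous_t_clamp (T : R) (f : R -> R) (t : R) : 0 <= t <= T ->
  filterlim f (within (fun s => 0 <= s <= T) (locally t)) (locally (f t)) ->
  continuous (fun s => f (clamp T s)) t.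
Proof.
intros Ht Hf P HP. rewrite clamp_id in HP by easy.
destruct (Hf P HP) as [d Hd]. exists d. intros s Hs.
apply Hd; [| apply clamp_bounds; lra].
apply Rle_lt_trans with (2 := Hs).
rewrite <- (clamp_id T t Ht) at 1. apply clamp_lipschitz.
Qed.

(** Space comes first here to match [uniform_continuity_2d_1d], whose first argument runs over a
    segment while the second stays near a point. *)
Lemma continuous_tx_clamp (T : R) (f : R -> R -> R) (t x : R) : 0 <= t <= T ->
  continuous_tx T f -> continuity_2d_pt (fun y s => f (clamp T s) y) x t.
Proof.
intros Ht Hf e.
destruct (proj1 (filterlim_locally _ _) (Hf (t, x) Ht) e) as [d Hd].
exists d. intros y s Hy Hs. rewrite (clamp_id T t Ht).
apply (Hd (clamp T s, y)); [| apply clamp_bounds; lra].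
split; simpl; [| exact Hy].
apply Rle_lt_trans with (2 := Hs).
rewrite <- (clamp_id T t Ht) at 1. apply clamp_lipschitz.
Qed.

Lemma continuous_tx_slice (T : R) (f : R -> R -> R) (t x : R) : 0 <= t <= T ->
  continuous_tx T f -> continuous (f t) x.
Proof.
intros Ht Hf. apply filterlim_locally. intros e.
destruct (proj1 (filterlim_locally _ _) (Hf (t, x) Ht) e) as [d Hd].
exists d. intros y Hy. apply (Hd (t, y)); [| exact Ht].
split; [apply ball_center | exact Hy].
Qed.

Lemma continuous_tx_mult (T : R) (f g : R -> R -> R) :
  continuous_tx T f -> continuous_tx T g -> continuous_tx T (fun t x => f t x * g t x).
Proof.
intros Hf Hg p Hp.
apply (filterlim_comp_2 _ _ Rmult (Hf p Hp) (Hg p Hp)).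
exact (filterlim_mult (K := R_AbsRing) _ _).
Qed.

Lemma continuous_tx_plus (T : R) (f g : R -> R -> R) :
  continuous_tx T f -> continuous_tx T g -> continuous_tx T (fun t x => f t x + g t x).
Proof.
intros Hf Hg p Hp.
apply (filterlim_comp_2 _ _ Rplus (Hf p Hp) (Hg p Hp)).
exact (filterlim_plus (V := R_NormedModule) _ _).
Qed.

(** * Mean value theorem and differentiation under the integral *)

Lemma is_derive_t_MVT (T : R) (f df : R -> R) (s t : R) :
  (forall r, 0 <= r <= T -> is_derive_t T f r (df r)) ->
  0 <= s <= T -> 0 <= t <= T ->
  exists c, Rmin t s <= c <= Rmax t s /\ f s - f t = df c * (s - t).
Proof.
intros Hf Hs Ht.
assert (B : 0 <= Rmin t s /\ Rmax t s <= T).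
{ split; [apply Rmin_glb | apply Rmax_lub]; lra. }
(* The segment may touch [0] or [T], where [f] is only known from one side; the clamped function is
   continuous there and coincides with [f] around interior points. *)
destruct (MVT_gen (fun r => f (clamp T r)) t s df) as [c [Hc E]].
- intros r Hr.
  apply (is_derive_ext_loc f).
  + assert (He : 0 < Rmin r (T - r)) by (apply Rmin_pos; lra).
    exists (mkposreal _ He). intros y Hy.
    apply Rabs_lt_between' in Hy; simpl in Hy.
    rewrite clamp_id; [easy |].
    generalize (Rmin_l r (T - r)) (Rmin_r r (T - r)); lra.
  + apply (is_derive_t_interior T); [lra | apply Hf; lra].
- intros r Hr. apply continuity_pt_filterlim.
  apply continuous_t_clamp; [lra |].
  apply (is_derive_t_continuous T f r (df r)), Hf; lra.
- exists c. rewrite !clamp_id in E by easy. now split.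
Qed.

(** By the mean value theorem in time, the remainder of [h] at each [x] is
    [(dh c x - dh t x) * (s - t)] with [c] between [t] and [s]; uniform continuity of [dh] makes the
    first factor small for all [x] in [[a, b]] at once. *)
Lemma is_derive_t_RInt (T a b : R) (h dh : R -> R -> R) (t : R) : a <= b ->
  (forall s x, 0 <= s <= T -> is_derive_t T (fun r => h r x) s (dh s x)) ->
  (forall s, 0 <= s <= T -> ex_RInt (h s) a b) ->
  continuous_tx T dh -> 0 <= t <= T ->
  is_derive_t T (fun s => RInt (h s) a b) t (RInt (dh t) a b).
Proof.
intros Hab Hd Hi Hc Ht.
apply is_derive_t_eps; [easy |]. intros e.
(* The [+ 1] covers [a = b]; multiplied by the length [b - a], this tolerance stays below [e]. *)
assert (He : 0 < e / (b - a + 1)).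
{ apply Rdiv_lt_0_compat; [apply cond_pos | lra]. }
destruct (uniform_continuity_2d_1d (fun y s => dh (clamp T s) y) a b t
  (fun x _ => continuous_tx_clamp T dh t x Ht Hc) (mkposreal _ He)) as [d Ud].
exists d. intros s Hs Hst.
assert (Id : ex_RInt (dh t) a b).
{ apply (ex_RInt_continuous (V := R_CompleteNormedModule)).
  intros z _. now apply (continuous_tx_slice T). }
assert (I1 : ex_RInt (fun x => minus (h s x) (h t x)) a b)
  by (apply (ex_RInt_minus (V := R_NormedModule)); auto).
assert (I2 : ex_RInt (fun x => scal (s - t) (dh t x)) a b)
  by (apply (ex_RInt_scal (V := R_NormedModule)); auto).
replace (RInt (h s) a b - RInt (h t) a b - (s - t) * RInt (dh t) a b)
  with (RInt (fun x => minus (minus (h s x) (h t x)) (scal (s - t) (dh t x))) a b).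
2:{ rewrite (RInt_minus (V := R_CompleteNormedModule)) by easy.
    rewrite (RInt_minus (V := R_CompleteNormedModule)) by auto.
    rewrite (RInt_scal (V := R_CompleteNormedModule)) by easy. reflexivity. }
apply Rle_trans with ((b - a) * (e / (b - a + 1) * Rabs (s - t))).
- apply abs_RInt_le_const; [easy | now apply (ex_RInt_minus (V := R_NormedModule)) |].
  intros x Hx.
  destruct (is_derive_t_MVT T (fun r => h r x) (fun r => dh r x) s t)
    as [c [Hc1 E]]; auto.
  (* The point [c] varies with [x], but its distance to [t] is bounded independently of [x], so the
     uniform [d] applies. *)
  assert (Hct : Rabs (c - t) <= Rabs (s - t)).
  { revert Hc1; unfold Rmin, Rmax, Rabs;
      repeat destruct Rle_dec; repeat destruct Rcase_abs; lra. }
  assert (HcT : 0 <= c <= T).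
  { revert Hc1; unfold Rmin, Rmax; repeat destruct Rle_dec; lra. }
  replace (minus (minus (h s x) (h t x)) (scal (s - t) (dh t x)))
    with ((dh c x - dh t x) * (s - t)).
  2:{ unfold minus, plus, opp, scal; simpl; unfold mult; simpl.
      replace (h s x + - h t x) with (h s x - h t x) by ring. rewrite E. ring. }
  rewrite Rabs_mult. apply Rmult_le_compat_r; [apply Rabs_pos |].
  apply Rlt_le.
  assert (Hcd : Rabs (c - t) < d) by lra.
  apply Rabs_lt_between' in Hcd.
  generalize (Ud x t x c). rewrite !clamp_id by easy.
  generalize (cond_pos d); intros Hdp HU.
  apply HU; try lra.
  rewrite Rminus_diag, Rabs_R0; lra.
- rewrite <- Rmult_assoc. apply Rmult_le_compat_r; [apply Rabs_pos |].
  replace ((b - a) * (e / (b - a + 1))) with (e - e / (b - a + 1)) by (field; lra).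
  lra.
Qed.

(** * Space integrals over one period *)

Lemma flux_eq (u q : R -> R) (x : R) :
  (forall y, ex_derive u y) -> (forall y, ex_derive (Derive u) y) ->
  flux u q x = q x - u x ^ 2 + (Derive u x ^ 2 + u x * Derive (Derive u) x).
Proof.
intros H1 H2. unfold flux. rewrite dg_duE.
rewrite (Derive_ext _ (fun y => u y * - Derive u y))
  by (intros y; now rewrite dg_duxE).
rewrite (is_derive_unique _ x (- (Derive u x ^ 2 + u x * Derive (Derive u) x))).
- ring.
- auto_derive; [now split |].
  change (Derive (fun s => u s) x) with (Derive u x).
  change (Derive (fun s => Derive u s) x) with (Derive (Derive u) x). ring.
Qed.

(* Since [w - w'' = F'], the primitive [W] of [w] satisfies [F = W - w' + c], and
   it is periodic because [F] and [w'] are; so [w F] is the derivative of the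
   periodic function [W^2/2 - w^2/2 + c W]. *)
Lemma is_D_primitive (L a : R) (F w : R -> R) : is_D L F w ->
  exists W, periodic L W /\ forall x, is_derive W x (w x * F x).
Proof.
intros [PF [DF [Pw [Dw Hw]]]].
assert (D1 : forall x, is_derive w x (Derive w x))
  by (intros x; apply Derive_correct, (Dw x)).
assert (D2 : forall x, is_derive (Derive w) x (Derive (Derive w) x))
  by (intros x; apply Derive_correct, (Dw x)).
assert (Cw : forall x, continuous w x).
{ intros x. apply (ex_derive_continuous (V := R_NormedModule)).
  now exists (Derive w x). }
set (W := fun x => RInt w a x).
assert (DW : forall x, is_derive W x (w x)).
{ intros x. apply (is_derive_RInt (V := R_NormedModule) w W a x); [| apply Cw].
  apply filter_forall. intros y.
  apply (RInt_correct (V := R_CompleteNormedModule)).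
  apply (ex_RInt_continuous (V := R_CompleteNormedModule)); auto. }
assert (K : forall x y, F x - (W x - Derive w x) = F y - (W y - Derive w y)).
{ apply (derive_zero_const (fun x => F x - (W x - Derive w x))). intros x.
  replace 0 with (minus (Derive F x) (minus (w x) (Derive (Derive w) x))).
  - apply @is_derive_minus; [now apply Derive_correct |].
    apply @is_derive_minus; auto.
  - unfold minus, plus, opp; simpl. specialize (Hw x); simpl in Hw.
    change (Derive (fun y => w y)) with (Derive w) in Hw.
    change (Derive (fun y => Derive w y) x) with (Derive (Derive w) x) in Hw. lra. }
set (c := F a - (W a - Derive w a)).
assert (PW : periodic L W).
{ intros x. specialize (K (x + L) x).
  rewrite PF, (periodic_Derive L w Pw) in K. lra. }
exists (fun x => W x ^ 2 / 2 - w x ^ 2 / 2 + c * W x). split.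
- intros x. now rewrite PW, Pw.
- intros x. auto_derive.
  + split; [now exists (w x) |]. split; [now exists (Derive w x) |].
    split; [now exists (w x) | easy].
  + change (Derive (fun s => W s) x) with (Derive W x).
    change (Derive (fun s => w s) x) with (Derive w x).
    rewrite (is_derive_unique _ _ _ (DW x)).
    replace (F x) with (W x - Derive w x + c) by (unfold c; specialize (K x a); lra).
    field.
Qed.

Lemma energy_rate_zero (a L : R) (u q w qt : R -> R) :
  (forall x, ex_derive u x) -> (forall x, ex_derive (Derive u) x) ->
  periodic L u -> is_D L (flux u q) w ->
  (forall x, qt x = dg_du (u x) (Derive u x) * w x
                    + dg_dux (u x) (Derive u x) * Derive w x) ->
  (forall x, continuous (fun y => w y * q y + u y * qt y) x) ->
  RInt (fun x => w x * q x + u x * qt x) a (a + L) = 0.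
Proof.
intros D1 D2 Pu HD Hq Hc.
destruct (is_D_primitive L a _ _ HD) as [W [PW DW]].
destruct HD as [_ [_ [Pw [Dw _]]]].
(* A periodic antiderivative of the integrand: [W] contributes [w * flux], and differentiating the
   second term cancels the part [(u u_x)_x] of the flux, leaving [- u u_x w_x], which is the
   [dg_dux] term of [u * qt]. *)
set (P := fun x => W x - w x * u x * Derive u x).
apply (is_RInt_unique (V := R_CompleteNormedModule)).
replace 0 with (minus (P (a + L)) (P a)).
2:{ unfold P. rewrite PW, Pw, Pu, (periodic_Derive L u Pu).
    apply (minus_eq_zero (G := R_AbelianGroup)). }
apply (is_RInt_derive (V := R_CompleteNormedModule) P); [| intros; apply Hc].
intros x _. unfold P. auto_derive.
- split; [now exists (w x * flux u q x) |].
  split; [apply (Dw x) |]. split; [apply D1 |]. split; [apply D2 | easy].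
- change (Derive (fun s => W s) x) with (Derive W x).
  change (Derive (fun s => w s) x) with (Derive w x).
  change (Derive (fun s => u s) x) with (Derive u x).
  change (Derive (fun s => Derive u s) x) with (Derive (Derive u) x).
  rewrite (is_derive_unique _ _ _ (DW x)), (flux_eq u q x D1 D2), Hq.
  rewrite dg_duE, dg_duxE. ring.
Qed.

Theorem theorem2p1 (a L T : R) (HL : 0 < L) (HT : 0 < T)
    (u0 : R -> R) (u q : R -> R -> R) (Hsol : is_solution L T u0 u q) :
  forall t, 0 <= t <= T -> is_derive_t T (energy a L u q) t 0.
Proof.
destruct Hsol as (ut & qt & Ht & (Su & Sut & Sq & Sqt) & Hp & HD & Hq & _).
intros t Htt.
assert (Cu : continuous_tx T u) by apply (Su 0%nat ltac:(lia)).
assert (Cut : continuous_tx T ut) by apply (Sut 0%nat ltac:(lia)).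
assert (Cq : continuous_tx T q) by apply (Sq 0%nat ltac:(lia)).
assert (Cqt : continuous_tx T qt) by apply (Sqt 0%nat ltac:(lia)).
set (dh := fun s x => ut s x * q s x + u s x * qt s x).
assert (Cdh : continuous_tx T dh)
  by (apply continuous_tx_plus; now apply continuous_tx_mult).
assert (E : RInt (dh t) a (a + L) = 0).
{ apply energy_rate_zero.
  - intros x. apply (Su 1%nat ltac:(lia)); easy.
  - intros x. apply (Su 2%nat ltac:(lia)); easy.
  - now apply Hp.
  - now apply HD.
  - intros x. now apply Hq.
  - intros x. now apply (continuous_tx_slice T dh). }
(* The derivative [0] is traded for the integral of [dh], the form produced by differentiating under
   the integral. *)
rewrite <- E.
apply (is_derive_t_RInt T a (a + L) (fun s x => u s x * q s x) dh);
  [lra | | | easy | easy].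
- intros s x Hs. destruct (Ht s x Hs) as [Hu Hqs].
  exact (is_derive_t_mult T (fun r => u r x) (fun r => q r x) s _ _ Hs Hu Hqs).
- intros s Hs. apply (ex_RInt_continuous (V := R_CompleteNormedModule)).
  intros x _. apply (continuous_tx_slice T (fun s x => u s x * q s x)); [easy |].
  now apply continuous_tx_mult.
Qed.
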